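(* Let $(S,s)$ be a finite commutative non-degenerate solution. Then $(S,s)$ is irretractable if and only if $\mathcal{G}(S,s)$ acts regularly on $S$.
   Context: A solution (set-theoretic solution of the Pentagon Equation) is a pair $(S,s)$ with $S$ a non-empty set and $s:S\times S\to S\times S$ a map such that $s_{23}s_{13}s_{12}=s_{12}s_{23}$ as maps $S^3\to S^3$, where $s_{12}=s\times \mathrm{id}$, $s_{23}=\mathrm{id}\times s$, $s_{13}=(\tau\times \mathrm{id})(\mathrm{id}\times s)(\tau\times \mathrm{id})$ and $\tau(x,y)=(y,x)$. Writing $s(x,y)=(x\cdot y,\theta_x(y))$, the pair $(S,s)$ is a solution if and only if for all $x,y,z\in S$: $(x\cdot y)\cdot z=x\cdot(y\cdot z)$, $\theta_x(y)\cdot\theta_{x\cdot y}(z)=\theta_x(y\cdot z)$, and $\theta_{\theta_x(y)}\theta_{x\cdot y}=\theta_y$. It is finite if $S$ is finite. It is commutative if $s_{12}s_{13}=s_{13}s_{12}$, equivalently $x\cdot y\cdot z=x\cdot z\cdot y$ and $\theta_{x\cdot y}=\theta_x$ for all $x,y,z\in S$. It is non-degenerate if every $\theta_x:S\to S$ is bijective. For a non-degenerate solution, $\mathcal{G}(S,s)$ is the subgroup of $\mathrm{Sym}(S)$ generated by $\{\theta_x: x\in S\}$. For a commutative non-degenerate solution, the retract relation is $x\sim y\iff\theta_x=\theta_y$; it induces a solution $\mathrm{Ret}(S,s)$ on $S/\!\sim$ by $\bar s(\bar x,\bar y)=(\overline{x\cdot y},\overline{\theta_x(y)})$. The solution is irretractable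 if $(S,s)=\mathrm{Ret}(S,s)$, i.e. $\theta_x=\theta_y$ implies $x=y$. A group acts regularly if it acts transitively with trivial point stabilizers. *)

(* Defs.v *)
From mathcomp Require Import all_boot all_fingroup.
Set Implicit Arguments.
Unset Strict Implicit.
Unset Printing Implicit Defensive.

Section Maps.

Variables (S : Type) (s : S * S -> S * S).

(* S^3 is encoded as S * S * S = (S * S) * S. *)
Definition s12 (t : S * S * S) : S * S * S := (s t.1, t.2).

Definition s23 (t : S * S * S) : S * S * S :=
  let: (x, y, z) := t in let: (y', z') := s (y, z) in (x, y', z').

Definition tau12 (t : S * S * S) : S * S * S :=
  let: (x, y, z) := t in (y, x, z).

Definition s13 : S * S * S -> S * S * S := tau12 \o s23 \o tau12.

Definition pentagon_solution : Prop :=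
  inhabited S /\ s23 \o s13 \o s12 =1 s12 \o s23.

Definition commutative_solution : Prop := s12 \o s13 =1 s13 \o s12.

Definition theta (x y : S) : S := (s (x, y)).2.

Definition nondegenerate : Prop := forall x, bijective (theta x).

Definition retract_rel (x y : S) : Prop := theta x =1 theta y.

(* Ret(S, s) = (S, s): all classes of the retract relation are singletons. *)
Definition irretractable : Prop := forall x y, retract_rel x y -> x = y.

End Maps.

Section PermutationGroup.

Variables (S : finType) (s : S * S -> S * S) (nd : nondegenerate s).

Definition theta_perm (x : S) : {perm S} := perm (bij_inj (nd x)).

(* MathComp's product of permutations is composition in diagrammatic order;
   this does not affect the subgroup generated by a set. *)
Definition theta_group : {group {perm S}} := <<[set theta_perm x | x : S]>>%G.

End PermutationGroup.

Definition acts_regularly (S : finType) (G : {group {perm S}}) : Prop :=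
  [transitive G, on [set: S] | 'P] /\ forall x : S, 'C_G[x | 'P]%g = 1%g.

(* Main.v *)
Require Import Defs.
From mathcomp Require Import all_boot all_fingroup.

(** Commutativity reduces the pentagon equation to
    theta_(theta_x y) o theta_x = theta_y ([theta_theta]).  Hence the maps
    theta_x are closed under (a, b) |-> b a^-1, so they already form a group,
    which is the whole of G(S, s) ([theta_groupP]).  The same identity says
    that x |-> theta_x intertwines the action of G(S, s) on S with the action
    of the group on itself by g . h = h g^-1 ([theta_perm_theta]), which is
    regular.  If the solution is irretractable this map identifies S with
    the group, and regularity transfers to S.  Conversely, if
    theta_x = theta_y and some theta_z sends x to y, then
    theta_y = theta_x theta_z^-1 forces theta_z = 1, whence x = y: transitivity
    alone gives irretractability. *)

Section CommutativeSolutions.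

Variables (S : Type) (s : S * S -> S * S).
Hypotheses (s_sol : pentagon_solution s) (s_comm : commutative_solution s).

(** This is the middle coordinate of s12 s13 = s13 s12, evaluated at (x, y, z). *)
Lemma theta_prod x z y : theta s (s (x, z)).1 y = theta s x y.
Proof.
have /(congr1 (fun t => t.1.2)) := s_comm (x, y, z).
rewrite /s12 /s13 /s23 /tau12 /theta /=.
by case: (s (x, z)) => a b; case: (s (x, y)) => c d /=; case: (s (c, z)).
Qed.

(** This is the last coordinate of the pentagon equation, with
    [theta_prod] used to drop the product from the index. *)
Lemma theta_theta x y z :
  theta s (theta s x y) (theta s x z) = theta s y z.
Proof.
case: s_sol => _ /(_ (x, y, z)).
rewrite -(theta_prod x y z) /s12 /s13 /s23 /tau12 /theta /=.
case: (s (x, y)) => a b /=; case: (s (a, z)) => c d /=.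
by case: (s (b, d)) => e f /=; case: (s (y, z)) => g h [].
Qed.

End CommutativeSolutions.

Section ThetaGroup.

Variables (S : finType) (s : S * S -> S * S).
Hypotheses (s_sol : pentagon_solution s) (s_comm : commutative_solution s).
Variable s_nd : nondegenerate s.

Local Notation "'th' x" := (theta_perm s_nd x) (at level 10, x at level 8).
Local Open Scope group_scope.

(** The product of permutations is in diagrammatic order, so the right-hand
    side is theta_y o theta_x^-1. *)
Lemma theta_perm_theta x y : th (th x y) = (th x)^-1 * th y.
Proof.
apply: (mulgI (th x)); rewrite mulKVg; apply/permP => z.
by rewrite permM !permE theta_theta.
Qed.

(** A nonempty set closed under (a, b) |-> a^-1 b is a subgroup, so generating
    adds nothing to the maps theta_x. *)
Lemma theta_groupP g : g \in theta_group s_nd <-> exists x, g = th x.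
Proof.
case: (s_sol) => -[x0] _.
have th1 : th (th x0 x0) = 1 by rewrite theta_perm_theta mulVg.
have grpA : group_set [set th x | x : S].
  apply/group_setP; split; first by rewrite -th1 imset_f.
  move=> _ _ /imsetP[x _ ->] /imsetP[y _ ->].
  (* Acting on an element of trivial theta inverts: w has th w = (th x)^-1. *)
  pose w := th x (th x0 x0).
  have thw : th w = (th x)^-1 by rewrite theta_perm_theta th1 mulg1.
  by rewrite -[th x]invgK -thw -theta_perm_theta imset_f.
have -> : (g \in theta_group s_nd) = (g \in [set th x | x : S]).
  by rewrite /theta_group /= -[[set _ | _ : S]]/(gval (Group grpA)) genGid.
by split=> [/imsetP[x _ ->] | [x ->]]; [exists x | apply: imset_f].
Qed.

Lemma retract_relP x y : retract_rel s x y <-> th x = th y.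
Proof.
split=> [eq_xy | /permP eq_xy z]; last by have := eq_xy z; rewrite !permE.
by apply/permP => z; rewrite !permE.
Qed.

Lemma regular_of_irretractable :
  irretractable s -> acts_regularly (theta_group s_nd).
Proof.
move=> irr; have th_inj x y : th x = th y -> x = y.
  by move/retract_relP; apply: irr.
split=> [|y].
  case: (s_sol) => -[x0] _; apply/imsetP; exists x0 => //.
  apply/setP => z; rewrite inE; apply/esym/orbitP.
  (* th x0 * (th z)^-1 sends x0 to z: it solves g^-1 * th x0 = th z. *)
  have /theta_groupP[x Dx] : th x0 * (th z)^-1 \in theta_group s_nd.
    by rewrite groupM ?groupV //; apply/theta_groupP; [exists x0 | exists z].
  exists (th x); first by apply/theta_groupP; exists x.
  by apply: th_inj; rewrite /= apermE theta_perm_theta -Dx invMg invgK mulgKV.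
apply/trivgP/subsetP => g; rewrite inE => /andP[/theta_groupP[x ->]].
move/astab1P; rewrite /= apermE => fix_y; apply/set1P.
have := theta_perm_theta x y; rewrite fix_y -{1}[th y]mul1g.
by move/mulIg/esym/eqP; rewrite invg_eq1 => /eqP.
Qed.

Lemma irretractable_of_transitive :
  [transitive theta_group s_nd, on [set: S] | 'P] -> irretractable s.
Proof.
move=> trG x y /retract_relP eq_xy.
have [g /theta_groupP[z ->]] := atransP2 trG (in_setT x) (in_setT y).
rewrite /= apermE => Dy; have := theta_perm_theta z x.
rewrite -Dy -eq_xy -{1}[th x]mul1g => /mulIg/esym/eqP.
by rewrite invg_eq1 => /eqP thz1; rewrite Dy thz1 perm1.
Qed.

End ThetaGroup.

Theorem theorem18 (S : finType) (s : S * S -> S * S)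
  (s_sol : pentagon_solution s) (s_comm : commutative_solution s)
  (s_nd : nondegenerate s) :
  irretractable s <-> acts_regularly (theta_group s_nd).
Proof.
split; first exact: regular_of_irretractable.
by case=> trG _; apply: irretractable_of_transitive trG.
Qed.
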